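(* Let $\lambda_1,\lambda_2,\lambda_3$ be positive integers with $\lambda_1=\max\{\lambda_1,\lambda_2,\lambda_3\}$ and $\lambda_1<\lambda_2+\lambda_3$. Then the sun $S(3;\lambda_1,\lambda_2,\lambda_3)$ has no connected partition of type $(\lambda_2+\lambda_3+1,\ \lambda_1+2)$, and thus it is not $e$-positive.
   Context: All graphs are finite and simple. $P_k$ denotes the path with $k$ vertices; for $k=1$ the single vertex counts as its leaf. For positive integers $\lambda_1,\lambda_2,\lambda_3$, the sun graph $S(3;\lambda_1,\lambda_2,\lambda_3)$ is obtained from the triangle with vertices $v_1,v_2,v_3$ and three disjoint paths $P_{\lambda_1},P_{\lambda_2},P_{\lambda_3}$ (disjoint from the triangle) by connecting $v_i$ by an edge to a leaf of $P_{\lambda_i}$ for $i=1,2,3$. A connected partition of a graph $G$ is a partition $\{V_1,\ldots,V_r\}$ of its vertex set such that every induced subgraph $G[V_i]$ is connected; its type is the integer partition whose parts are the sizes $|V_1|,\ldots,|V_r|$. The chromatic symmetric function of a graph $G$ with vertices $v_1,\ldots,v_d$ is $X_G=\sum_{\kappa} x_{\kappa(v_1)}\cdots x_{\kappa(v_d)}$, the sum over all proper colourings $\kappa:V(G)\to\mathbb{N}$, with $x_1,x_2,\ldots$ commuting variables. $G$ is $e$-positive if all coefficients of $X_G$ in the basis $\{e_\lambda\}$ of elementary symmetric functions ($e_\lambda=e_{\lambda_1}e_{\lambda_2}\cdots$) are nonnegative. *)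

(* Defs.v *)
From HB Require Import structures.
From mathcomp Require Import all_boot all_algebra.
From mathcomp Require Import finmap multiset.
From mathcomp Require Import boolp classical_sets functions cardinality fsbigop.

Set Implicit Arguments.
Unset Strict Implicit.
Unset Printing Implicit Defensive.

Import GRing.Theory Num.Theory.

Local Open Scope ring_scope.

Record sgraph := SGraph {
  vertex :> finType;
  edge : rel vertex;
  edge_sym : symmetric edge;
  edge_irr : irreflexive edge }.

Section Graphs.
Variable G : sgraph.

Definition connected_graph : Prop :=
  (0 < #|G|)%N /\ forall x y : G, connect (@edge G) x y.

Definition proper_coloring (kappa : {ffun G -> nat}) : Prop :=
  forall x y : G, edge x y -> kappa x != kappa y.

Section Induced.
Variable A : {set G}.

Definition induced_edge : rel {x : G | x \in A} :=
  fun u v => edge (val u) (val v).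

Lemma induced_edge_sym : symmetric induced_edge.
Proof. by move=> u v; exact: edge_sym. Qed.

Lemma induced_edge_irr : irreflexive induced_edge.
Proof. by move=> u; exact: edge_irr. Qed.

Definition induced : sgraph := SGraph induced_edge_sym induced_edge_irr.

End Induced.
End Graphs.

Definition is_intpart (s : seq nat) : bool := sorted geq s && (0%N \notin s).

Record intpart := IntPart { parts :> seq nat; _ : is_intpart parts }.
HB.instance Definition _ := [isSub for parts].
HB.instance Definition _ := [Choice of intpart by <:].

Definition connected_partition (G : sgraph) (P : {set {set G}}) : Prop :=
  finset.partition P [set: G]%SET /\
  forall A : {set G}, A \in P -> connected_graph (induced A).

Definition partition_type (G : sgraph) (P : {set {set G}}) : seq nat :=
  sort geq [seq #|A| | A : {set G} <- enum P].

Definition has_connected_partition (G : sgraph) (s : seq nat) : Prop :=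
  exists2 P : {set {set G}}, connected_partition P & partition_type P = s.

(* A monomial is the multiset of its variables, so that [A `+` B] is the
   product of the monomials A and B; a power series is the function giving
   its coefficients. *)
Definition monomial := multiset nat.
Definition series := monomial -> rat.

Definition ps_one : series := fun m => (m == mset0)%:R.

Definition ps_mul (f g : series) : series := fun m =>
  \sum_(p \in [set p : monomial * monomial | (p.1 `+` p.2)%mset = m]%classic)
    f p.1 * g p.2.

(* The formal sum of the monomials [mon i] for i in D. Each coefficient is a
   finitely supported sum as soon as [mon] has finite fibres on D, which holds
   in both uses below. *)
Definition ps_sum (I : choiceType) (D : set I) (mon : I -> monomial) : series :=
  fun m => \sum_(i \in D) ((mon i == m)%:R : rat).

Definition elem (k : nat) : series :=
  ps_sum [set A : {fset nat} | #|` A|%fset = k]%classic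
         (fun A : {fset nat} => seq_mset (enum_fset A)).

Definition elem_part (la : intpart) : series :=
  \big[ps_mul/ps_one]_(k <- parts la) elem k.

Definition chromatic_sym (G : sgraph) : series :=
  ps_sum [set kappa : {ffun G -> nat} | proper_coloring kappa]%classic
         (fun kappa : {ffun G -> nat} => seq_mset [seq kappa v | v <- enum G]).

(* [c] is the finitely supported family of coefficients of [f] in the family
   of the e_la; it is unique since the e_la are linearly independent. *)
Definition e_expansion (f : series) (c : {fsfun intpart -> rat with 0}) : Prop :=
  forall m : monomial,
    f m = \sum_(la <- finsupp c) c la * elem_part la m.

Definition e_positive (G : sgraph) : Prop :=
  exists2 c : {fsfun intpart -> rat with 0},
    e_expansion (chromatic_sym G) c & forall la : intpart, 0 <= c la.

Section Sun.
Variables l1 l2 l3 : nat.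

Definition sun_arm (i : 'I_3) : nat := tnth [tuple l1; l2; l3] i.

(* [inl i] is the triangle vertex v_i and [inr (Tagged _ k)] is the k-th vertex
   of the path attached to it, counted from 0 along the path; vertex 0 is the
   leaf adjacent to v_i. *)
Definition sun_vertex : finType := ('I_3 + {i : 'I_3 & 'I_(sun_arm i)})%type.

Definition sun_edge : rel sun_vertex := fun u v =>
  match u, v with
  | inl i, inl j => i != j
  | inl i, inr q => (tag q == i) && (tagged q == 0%N :> nat)
  | inr p, inl j => (tag p == j) && (tagged p == 0%N :> nat)
  | inr p, inr q =>
      (tag p == tag q) &&
      (((tagged p).+1 == tagged q :> nat) || ((tagged q).+1 == tagged p :> nat))
  end.

Lemma sun_edge_sym : symmetric sun_edge.
Proof.
move=> [i|p] [j|q] //=; first by rewrite eq_sym.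
by rewrite [tag p == _]eq_sym orbC.
Qed.

Lemma sun_edge_irr : irreflexive sun_edge.
Proof.
move=> [i|p] /=; first by rewrite eqxx.
by rewrite eqxx orbb gtn_eqF.
Qed.

Definition sun3 : sgraph := SGraph sun_edge_sym sun_edge_irr.

End Sun.

(* Main.v *)
Require Import Defs.
From mathcomp Require Import finmap multiset.
From mathcomp Require Import boolp classical_sets fsbigop.
From mathcomp Require Import all_boot all_order all_algebra all_field.
From mathcomp Require Import zify.

(** A vertex set that induces a connected subgraph of the sun and meets the
triangle in at most one vertex lies in one branch (a triangle vertex with its
path), hence has at most max(l1,l2,l3) + 1 vertices.  Two disjoint sets cannot
both contain two of the three triangle vertices, so in a connected partition
into two parts some part has at most l1 + 1 vertices, while both parts of the
given type have at least l1 + 2 ([no_connected_bipartition_of_big_parts]).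

The failure of e-positivity is Wolfgang's theorem: a connected e-positive graph
on n vertices has connected partitions of every type.  The case of a type
(a, b) with a + b = n is [connected_partition_of_e_positive].  Classically
one compares the coefficients of p_n and of p_a p_b in the power sum basis.
Here the coefficients are extracted by evaluating series at finite lists of
complex numbers.

Let Z_a be a list of a numbers z with prod (1 + z X) = 1 + X^a
([exists_roots_gf]).  Its j-th elementary symmetric value is 1 for j = 0 or
j = a and 0 otherwise, and its j-th power sum vanishes unless a divides j.
By Whitney's formula ([sum_proper_colorings]), the value of X_G at a list Z is
the sum over the edge sets S of (-1)^|S| times the product, over the
components C of (V, S), of the |C|-th power sum of Z.

- At Z_n only the S that connect all of V contribute, and their signed number
  is nonzero when G is connected ([connecting_sum_sign]).  So X_G does not
  vanish at Z_n, and in an e-expansion some e_la with all parts equal to n has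
  a nonzero coefficient.
- If G has no connected partition of type (a, b), then no S has distinct
  components C and C' with a dividing |C| and b dividing |C'|, and the value of X_G at the
  concatenation of Z_a and Z_b is the sum of its values at Z_a and at Z_b.
- On each e_la of degree n, the value at the concatenation is at least that
  sum ([prodr_superadditive]), and exceeds it by 1 when all parts are n.

With nonnegative coefficients these three facts contradict each other. *)

Set Implicit Arguments.
Unset Strict Implicit.
Unset Printing Implicit Defensive.
Import Order.TTheory GRing.Theory Num.Theory.
Local Open Scope ring_scope.

(** * Signed count of connecting edge sets *)

Lemma big_subset_setU1 (V : nmodType) (I : finType) (e : I) (E : {set I})
    (F : {set I} -> V) : e \notin E ->
  \sum_(S : {set I} | S \subset e |: E) F S =
  \sum_(S : {set I} | S \subset E) F S + \sum_(S : {set I} | S \subset E) F (e |: S).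
Proof.
move=> eE; rewrite (bigID (fun S : {set I} => e \in S)) /= addrC; congr (_ + _).
  apply: eq_bigl => S; apply/andP/idP => [[sS eS]|sS].
    apply/subsetP => i iS; have := subsetP sS _ iS.
    by rewrite !inE => /orP[/eqP ie|//]; rewrite -ie iS in eS.
  split; first exact: subset_trans sS (subsetUr _ _).
  by apply: contra eE; apply: (subsetP sS).
rewrite (reindex_onto (fun S => e |: S) (fun S => S :\ e)) /=; last first.
  by move=> S /andP[_ eS]; rewrite setD1K.
apply: eq_bigl => S; apply/andP/idP => [[/andP[sS _] /eqP <-]|sS].
  by rewrite subDset.
have eS : e \notin S by apply: contra eE; apply: (subsetP sS).
by rewrite setUS // !inE eqxx setU1K.
Qed.

Section Contraction.
Variables (T : finType) (R : numDomainType).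
Implicit Types (S E : {set T * T}) (g : T -> T).

(** The labelling [g] encodes a contraction of the vertex set: vertices with the
same label are identified.  This keeps the vertex type fixed during the
deletion-contraction recursion. *)
Definition contracted_edge S g : rel T :=
  fun u v => [|| g u == g v, (u, v) \in S | (v, u) \in S].

Definition connecting S g : bool :=
  [forall u, forall v, connect (contracted_edge S g) u v].

Definition connecting_sum E g : R :=
  \sum_(S : {set T * T} | S \subset E) (-1) ^+ #|S| *+ connecting S g.

Definition contract (x y : T) g : T -> T :=
  fun v => if g v == g x then g y else g v.

Lemma contracted_edge_sym S g : symmetric (contracted_edge S g).
Proof. by move=> u v; rewrite /contracted_edge eq_sym; congr (_ || _); rewrite orbC. Qed.

Lemma connect_contracted_sym S g : connect_sym (contracted_edge S g).
Proof. exact/sym_connect_sym/contracted_edge_sym. Qed.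

Lemma connectingP S g :
  reflect (forall u v, connect (contracted_edge S g) u v) (connecting S g).
Proof. exact: 'forall_forallP. Qed.

Lemma connectingS S S' g : S \subset S' -> connecting S g -> connecting S' g.
Proof.
move=> sSS' /connectingP cS; apply/connectingP => u v.
apply: connect_sub (cS u v) => {u v} u v /or3P[|/(subsetP sSS')|/(subsetP sSS')] h;
  by apply: connect1; rewrite /contracted_edge h ?orbT.
Qed.

Lemma connecting_loop x y S g : g x = g y ->
  connecting ((x, y) |: S) g = connecting S g.
Proof.
move=> gxy; apply/idP/idP; last exact/connectingS/subsetUr.
move=> /connectingP cS; apply/connectingP => u v.
apply: connect_sub (cS u v) => {u v} u v uv; apply: connect1.
move: uv; rewrite /contracted_edge !inE -!orbA.
case/or4P=> [->//|/eqP[-> ->]|->|]; rewrite ?gxy ?eqxx ?orbT//.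
by case/orP=> [/eqP[-> ->]|->]; rewrite ?gxy ?eqxx ?orbT.
Qed.

Lemma connecting_contract x y S g :
  connecting ((x, y) |: S) g = connecting S (contract x y g).
Proof.
apply/connectingP/connectingP => cS u v; apply: connect_sub (cS u v) => {u v} u v.
  rewrite /contracted_edge !inE -!orbA => h; apply: connect1; move: h.
  rewrite /contracted_edge /contract.
  case/or4P=> [/eqP->|/eqP[-> ->]|->|]; rewrite ?eqxx ?orbT//; first by case: ifP; rewrite eqxx.
  by case/orP=> [/eqP[-> ->]|->]; rewrite ?eqxx ?orbT//; case: ifP; rewrite eqxx.
have toy w : g w == g x -> connect (contracted_edge ((x, y) |: S) g) w y.
  move=> wx; apply: (@connect_trans _ _ x).
    by apply: connect1; rewrite /contracted_edge wx.
  by apply: connect1; rewrite /contracted_edge !inE eqxx orbT.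
have same w w' : g w == g w' -> connect (contracted_edge ((x, y) |: S) g) w w'.
  by move=> e; apply: connect1; rewrite /contracted_edge e.
case/or3P => [|h|h]; last 2 first.
- by apply: connect1; rewrite /contracted_edge !inE h !orbT.
- by apply: connect1; rewrite /contracted_edge !inE h !orbT.
rewrite /contract; case: ifP => [ux|_]; case: ifP => [vx|_] h; last exact: same.
- by apply: same; rewrite (eqP ux) (eqP vx).
- exact: connect_trans (toy _ ux) (same _ _ h).
- rewrite connect_contracted_sym; apply: connect_trans (toy _ vx) (same _ _ _).
  by rewrite eq_sym.
Qed.

(** Toggling a loop in S changes the sign of its term and not its connectivity,
so the terms cancel in pairs. *)
Lemma connecting_sum_loop x y E g : (x, y) \notin E -> g x = g y ->
  connecting_sum ((x, y) |: E) g = 0.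
Proof.
move=> eE gxy; rewrite /connecting_sum big_subset_setU1 // -big_split big1 //= => S sS.
have eS : (x, y) \notin S by apply: contra eE; apply: (subsetP sS).
by rewrite connecting_loop // cardsU1 eS exprS mulN1r mulNrn addrN.
Qed.

Lemma connecting_sum_deletion_contraction x y E g : (x, y) \notin E ->
  connecting_sum ((x, y) |: E) g =
  connecting_sum E g - connecting_sum E (contract x y g).
Proof.
move=> eE; rewrite /connecting_sum big_subset_setU1 //; congr (_ + _).
rewrite -sumrN; apply: eq_bigr => S sS.
have eS : (x, y) \notin S by apply: contra eE; apply: (subsetP sS).
by rewrite connecting_contract cardsU1 eS exprS mulN1r mulNrn.
Qed.

Lemma card_contract x y g : g x != g y ->
  #|contract x y g @: T|.+1 = #|g @: T|.
Proof.
move=> gxy; rewrite (cardsD1 (g x) (g @: T)) imset_f //= add1n; congr _.+1.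
apply: eq_card => w; rewrite !inE; apply/imsetP/andP => [[v _ ->]|[wx /imsetP[v _ wv]]].
  rewrite /contract; case: ifP => [_|/negbT ->]; rewrite ?imset_f //.
  by rewrite eq_sym.
by exists v => //; rewrite /contract -wv (negbTE wx).
Qed.

Lemma connecting0 g : (0 < #|T|)%N -> connecting set0 g = (#|g @: T| == 1)%N.
Proof.
move=> T0; have /card_gt0P[t _] := T0; apply/connectingP/cards1P => [c|[w gw] u v].
  exists (g t); apply/setP => w; rewrite inE; apply/imsetP/eqP => [[u _ ->]|->]; last by exists t.
  have /connectP[p + ->] := c t u.
  elim: p (t) => //= a p IH s /andP[+ /IH ->].
  by rewrite /contracted_edge !inE !orbF => /eqP.
have gE s : g s = w by apply/set1P; rewrite -gw imset_f.
by apply: connect1; rewrite /contracted_edge !gE eqxx.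
Qed.

(** The signed count of connecting edge sets is, up to sign, the linear
coefficient of the chromatic polynomial.  Deletion and contraction of an edge
that is not a loop contribute with the same sign, because contraction lowers
the number of labels by one; this gives the weak inequality.  Strictness, for a
connected loopless graph, comes from the deletion when the edge is not a bridge,
and otherwise from the contraction, which then creates no loop: an edge parallel
to a bridge would connect its ends. *)
Lemma connecting_sum_sign E g : (0 < #|T|)%N ->
  0 <= (-1) ^+ #|g @: T|.-1 * connecting_sum E g /\
  (connecting E g -> (forall p, p \in E -> g p.1 != g p.2) ->
   0 < (-1) ^+ #|g @: T|.-1 * connecting_sum E g).
Proof.
move=> T0; move: {2}_.+1 (ltnSn #|E|) => n; elim: n E g => // n IH E g.
have [->|[[x y] eE]] := set_0Vmem E => [_|].
  rewrite /connecting_sum (big_pred1 set0) => [|S]; last by rewrite subset0.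
  rewrite cards0 connecting0 //; case: eqP => [->|_] /=.
    by rewrite !expr0 mulr1 ltr01 ler01.
  by rewrite mulr0 lexx; split.
rewrite (cardsD1 (x, y)) eE ltnS add1n -{2 3 4 5}(setD1K eE).
move: (E :\ (x, y)) (setD11 (x, y) E) => E' /negbT eE' ltn.
have [gxy|gxy] := eqVneq (g x) (g y).
  rewrite connecting_sum_loop // mulr0; split=> // _ /(_ (x, y)).
  by rewrite !inE !eqxx gxy eqxx => /(_ isT).
rewrite connecting_sum_deletion_contraction //.
have cT : (#|g @: T|.-1 = (#|contract x y g @: T|.-1).+1)%N.
  rewrite -(card_contract gxy) /= prednK // card_gt0; apply/set0Pn.
  by have /card_gt0P[t _] := T0; exists (contract x y g t); rewrite imset_f.
have [IH1 IH1'] := IH E' g ltn; have [IH2 IH2'] := IH E' (contract x y g) ltn.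
have -> : (-1) ^+ #|g @: T|.-1 * (connecting_sum E' g - connecting_sum E' (contract x y g))
   = (-1) ^+ #|g @: T|.-1 * connecting_sum E' g
     + (-1) ^+ #|contract x y g @: T|.-1 * connecting_sum E' (contract x y g).
  by rewrite mulrBr {2}cT exprS mulN1r mulNr opprK.
split=> [|cE loopless]; first exact: addr_ge0.
have loopless' p : p \in E' -> g p.1 != g p.2.
  by move=> pE'; apply: loopless; apply/setU1P; right.
have [cE'|ncE'] := boolP (connecting E' g).
  by rewrite ltr_wpDr // IH1'.
rewrite ltr_wpDl // IH2' -?connecting_contract // => -[u v] uvE' /=.
(* A loop of the contraction would make [(x, y)] redundant, that is, no bridge. *)
apply: contra ncE' => cuv.
have := loopless' _ uvE'; rewrite /= => guv.
have cxy : connect (contracted_edge E' g) x y.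
  have cuvE : connect (contracted_edge E' g) u v.
    by apply: connect1; rewrite /contracted_edge uvE' orbT.
  have same w w' : g w = g w' -> connect (contracted_edge E' g) w w'.
    by move=> e; apply: connect1; rewrite /contracted_edge e eqxx.
  move: cuv; rewrite /contract; case: ifP => [/eqP ux|_]; case: ifP => [/eqP vx|_] /eqP h.
  - by rewrite ux vx eqxx in guv.
  - by apply: connect_trans (same _ _ _) (connect_trans cuvE (same _ _ _)).
  - rewrite connect_contracted_sym.
    by apply: connect_trans (same _ _ _) (connect_trans cuvE (same _ _ _)).
  - by rewrite h eqxx in guv.
apply/connectingP => s t; move/connectingP/(_ s t): cE; apply: connect_sub => {s t} s t.
rewrite /contracted_edge !inE -!orbA => h.
case/or4P: h => [h|/eqP[-> ->] //|h|/orP[/eqP[-> ->]|h]].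
- by apply: connect1; rewrite /contracted_edge h.
- by apply: connect1; rewrite /contracted_edge h orbT.
- by rewrite connect_contracted_sym.
- by apply: connect1; rewrite /contracted_edge h !orbT.
Qed.

End Contraction.

(** * Whitney's formula *)

Section Whitney.
Variable R : comNzRingType.

Lemma prod_one_sub (I : finType) (E : {set I}) (F : I -> R) :
  \prod_(i in E) (1 - F i) =
  \sum_(S : {set I} | S \subset E) (-1) ^+ #|S| * \prod_(i in S) F i.
Proof.
transitivity (\prod_i ((if i \in E then - F i else 0) + 1)).
  rewrite [LHS]big_mkcond; apply: eq_bigr => i _.
  by case: ifP => _; rewrite ?add0r // addrC.
rewrite (bigA_distr 1) /= (bigID (fun S : {set I} => S \subset E)) /=.
rewrite [X in _ + X]big1 ?addr0 => [|S /subsetPn[i iS iE]]; last first.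
  by rewrite (bigD1 i) //= iS (negbTE iE) mul0r.
apply: eq_bigr => S /subsetP sS; rewrite -prodr_const -big_split /= [RHS]big_mkcond.
by apply: eq_bigr => i _; case: ifP => // /sS ->; rewrite mulN1r.
Qed.

Definition constant_on_blocks (T : finType) (J : eqType) (P : {set {set T}})
    (kappa : T -> J) : bool :=
  [forall x, forall y, (pblock P x == pblock P y) ==> (kappa x == kappa y)].

(** A colouring constant on the blocks is a choice of one colour per block, so
the sum factors over the blocks. *)
Lemma sum_constant_on_blocks (T J : finType) (P : {set {set T}}) (F : J -> R) :
  partition P [set: T] ->
  \sum_(kappa : {ffun T -> J} | constant_on_blocks P kappa) \prod_v F (kappa v) =
  \prod_(C in P) \sum_j F j ^+ #|C|.
Proof.
move=> partP; have /and3P[/eqP coverP trivP P0] := partP.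
have inP v : pblock P v \in P by rewrite pblock_mem // coverP.
have rep (C : {C | C \in P}) : {x | x \in val C}.
  apply/sigW/set0Pn; apply: contra P0 => /eqP <-; exact: valP.
rewrite [RHS]big_sub [RHS]bigA_distr_bigA /=.
pose h (f : {ffun {C | C \in P} -> J}) := [ffun v => f (Sub (pblock P v) (inP v))].
pose h' (k : {ffun T -> J}) := [ffun C : {C | C \in P} => k (sval (rep C))].
have hK f : h' (h f) = f.
  apply/ffunP => C; rewrite !ffunE; congr (f _); apply: val_inj => /=.
  by apply: def_pblock => //; [exact: (valP C) | exact: (svalP (rep C))].
rewrite (reindex_onto h h') /= => [|k /'forall_forallP kP]; last first.
  apply/ffunP => v; rewrite !ffunE; apply/eqP/(implyP (kP _ _))/eqP.
  by apply: def_pblock => //; exact: (svalP (rep _)).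
apply: eq_big => [f|f _].
  rewrite hK eqxx andbT; apply/'forall_forallP => x y; apply/implyP => /eqP xy.
  by rewrite !ffunE; apply/eqP; congr (f _); apply: val_inj.
transitivity (\prod_(v in [set: T]) F (h f v)); first by apply: eq_bigl => v; rewrite inE.
rewrite (set_partition_big _ partP) /= big_sub.
apply: eq_bigr => C _; rewrite -prodr_const; apply: eq_bigr => v vC.
rewrite ffunE; congr (F (f _)); apply: val_inj => /=.
by apply: def_pblock => //; exact: (valP C).
Qed.

Definition components (T : finType) (S : {set T * T}) : {set {set T}} :=
  equivalence_partition (connect (contracted_edge S id)) [set: T].

Lemma connect_equivalence (T : finType) (S : {set T * T}) :
  {in [set: T] & &, equivalence_rel (connect (contracted_edge S id))}.
Proof.
move=> x y z _ _ _; split=> [|xy]; first exact: connect0.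
by apply: (same_connect (@connect_contracted_sym _ S id)).
Qed.

Lemma components_partition (T : finType) (S : {set T * T}) :
  partition (components S) [set: T].
Proof. exact/equivalence_partitionP/connect_equivalence. Qed.

Lemma mem_component (T : finType) (S : {set T * T}) (C : {set T}) x y :
  C \in components S -> x \in C ->
  (y \in C) = connect (contracted_edge S id) x y.
Proof.
have /and3P[_ trivS _] := components_partition S.
move=> CS xC; rewrite -(def_pblock trivS CS xC).
by rewrite pblock_equivalence_partition //; exact: connect_equivalence.
Qed.

Lemma component_pblock (T : finType) (S : {set T * T}) x :
  pblock (components S) x \in components S.
Proof.
have /and3P[/eqP coverS _ _] := components_partition S.
by rewrite pblock_mem // coverS.
Qed.

Lemma component_card (T : finType) (S : {set T * T}) (C : {set T}) :
  C \in components S -> (0 < #|C|)%N.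
Proof.
move=> CS; have /and3P[_ _ P0] := components_partition S.
by rewrite card_gt0; apply: contra P0 => /eqP <-.
Qed.

Lemma constant_on_components (T : finType) (J : eqType) (S : {set T * T})
    (kappa : T -> J) :
  constant_on_blocks (components S) kappa =
  [forall p in S, kappa p.1 == kappa p.2].
Proof.
have /and3P[/eqP coverP trivP _] := components_partition S.
have same x y : (pblock (components S) x == pblock (components S) y) =
    connect (contracted_edge S id) x y.
  rewrite eq_pblock ?coverP // pblock_equivalence_partition //.
  exact: connect_equivalence.
apply/'forall_forallP/forall_inP => [kP [x y] xyS /=|kS x y].
  apply: (implyP (kP _ _)); rewrite same; apply: connect1.
  by rewrite /contracted_edge xyS orbT.
rewrite same; apply/implyP => /connectP[p + ->].
elim: p x => //= z p IH x /andP[xz /IH /eqP <-].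
case/or3P: xz => [/eqP ->//|/kS //|/kS]; by rewrite eq_sym.
Qed.

(** Each edge is counted in both orientations.  This is harmless: the formula
below only uses that a colouring is proper when it separates all these pairs,
and the recursion above tolerates parallel edges. *)
Definition edge_set (G : sgraph) : {set G * G} := [set p | edge p.1 p.2].

(** The indicator of proper colourings is the product of 1 - [kappa x = kappa y]
over the edges; its expansion is a sum over edge sets S of indicators of the
colourings that are constant on the components of S. *)
Lemma sum_proper_colorings (G : sgraph) (J : finType) (F : J -> R) :
  \sum_(kappa : {ffun G -> J} | [forall p in edge_set G, kappa p.1 != kappa p.2])
    \prod_v F (kappa v) =
  \sum_(S : {set G * G} | S \subset edge_set G)
    (-1) ^+ #|S| * \prod_(C in components S) \sum_j F j ^+ #|C|.
Proof.
have indic (I : finType) (A : {set I}) (b : pred I) :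
    \prod_(i in A) ((b i)%:R : R) = [forall i in A, b i]%:R.
  have [/forall_inP bA|] := boolP [forall i in A, b i].
    by rewrite big1 // => i /bA ->.
  rewrite negb_forall_in => /exists_inP[i iA /negbTE bi].
  by rewrite (bigD1 i) //= bi mul0r.
rewrite big_mkcond /=.
transitivity (\sum_(kappa : {ffun G -> J}) \sum_(S : {set G * G} | S \subset edge_set G)
   (-1) ^+ #|S| * ([forall p in S, kappa p.1 == kappa p.2]%:R * \prod_v F (kappa v))).
  apply: eq_bigr => k _; transitivity (
    (\prod_(p in edge_set G) (1 - (k p.1 == k p.2)%:R)) * \prod_v F (k v)).
    rewrite (eq_bigr (fun p => (k p.1 != k p.2)%:R)) => [|p _]; last first.
      by case: eqP; rewrite ?subrr ?subr0.
    by rewrite (indic _ _ (fun p => k p.1 != k p.2)); case: ifP; rewrite ?mul1r ?mul0r.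
  rewrite prod_one_sub mulr_suml; apply: eq_bigr => S _.
  by rewrite (indic _ _ (fun p => k p.1 == k p.2)) mulrA.
rewrite exchange_big; apply: eq_bigr => S _; rewrite -mulr_sumr; congr (_ * _).
rewrite -sum_constant_on_blocks ?components_partition // [RHS]big_mkcond /=.
by apply: eq_bigr => k _; rewrite constant_on_components; case: ifP; rewrite ?mul1r ?mul0r.
Qed.

End Whitney.

(** * Evaluation of power series at finite lists of numbers *)

Section Evaluation.
Variable R : numFieldType.
Implicit Types (d n : nat) (m : multiset nat) (f g : series) (zs : seq R).

(** The monomials of degree [n] in the first [K] variables.  Restricting an
evaluation to one degree keeps it a finite sum, and discards the terms of an
e-expansion of any other degree. *)
Definition monomials (K n : nat) : seq (multiset nat) :=
  undup [seq seq_mset [seq val i | i <- t] | t : n.-tuple 'I_K].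

Lemma perm_msetD m m' : perm_eq (m `+` m')%mset (m ++ m').
Proof.
by apply/allP => i _ /=; rewrite count_cat !count_mem_mset msetE2.
Qed.

Lemma mem_monomials K n m :
  (m \in monomials K n) = (size m == n) && all (fun i => i < K)%N m.
Proof.
rewrite mem_undup; apply/mapP/andP => [[t _ ->]|[/eqP sz /allP mK]].
  have pt := perm_eq_seq_mset [seq val i | i <- t].
  rewrite (perm_size pt) size_map size_tuple eqxx; split=> //.
  by apply/allP => i; rewrite (perm_mem pt) => /mapP[j _ ->] /=; exact: ltn_ord.
have sz' : size (pmap insub m : seq 'I_K) == n.
  by rewrite size_pmap_sub -sz -all_count; apply/allP.
exists (Tuple sz') => /=; first by rewrite mem_enum.
rewrite -[LHS]seq_mset_id; congr seq_mset.
elim: (m : seq nat) mK => //= i s IH sK.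
rewrite insubT ?sK ?mem_head //= => iK; rewrite -IH // => j js.
by rewrite sK // inE js orbT.
Qed.

Definition weight zs m : R := \prod_(i <- m) zs`_i.

Lemma weightD zs m m' : weight zs (m `+` m')%mset = weight zs m * weight zs m'.
Proof. by rewrite /weight (perm_big _ (perm_msetD m m')) big_cat. Qed.

Definition homogeneous n f := forall m, size m != n -> f m = 0.

Definition evaluate zs n f : R :=
  \sum_(m <- monomials (size zs) n) ratr (f m) * weight zs m.

Lemma evaluate_homogeneous zs d n f :
  homogeneous d f -> d != n -> evaluate zs n f = 0.
Proof.
move=> hf dn; rewrite /evaluate big1_seq // => m /=.
rewrite mem_monomials => /andP[/eqP sz _].
by rewrite hf ?rmorph0 ?mul0r // sz eq_sym.
Qed.

Lemma homogeneous_mul (d d' : nat) f g :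
  homogeneous d f -> homogeneous d' g -> homogeneous (d + d') (ps_mul f g).
Proof.
move=> hf hg m sm; rewrite /ps_mul fsbig1 // => -[m1 m2] /= mE.
have [sm1|/hf -> ] := eqVneq (size (m1 : multiset nat)) d; last by rewrite mul0r.
rewrite hg ?mulr0 //; apply: contra sm => /eqP <-.
by rewrite -mE (perm_size (perm_msetD _ _)) size_cat sm1.
Qed.

(** By homogeneity, the finitely many splittings of a monomial that contribute
to its coefficient in the product are pairs of monomials of degrees [d] and
[d'] in the same variables. *)
Lemma evaluate_mul zs (d d' : nat) f g : homogeneous d f -> homogeneous d' g ->
  evaluate zs (d + d') (ps_mul f g) = evaluate zs d f * evaluate zs d' g.
Proof.
move=> hf hg; set K := size zs.
pose L := [seq (m1, m2) | m1 <- monomials K d, m2 <- monomials K d'].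
have L_uniq : uniq L.
  by apply: allpairs_uniq => [||[? ?] [? ?] _ _ //]; apply: undup_uniq.
have mulE m : m \in monomials K (d + d') ->
    ps_mul f g m = \sum_(p <- L) if (p.1 `+` p.2)%mset == m then f p.1 * g p.2 else 0.
  rewrite mem_monomials => /andP[_ /allP mK].
  rewrite -big_mkcond -big_filter /ps_mul (fsbigE [seq p <- L | (p.1 `+` p.2)%mset == m]).
  - rewrite [LHS]big_seq_cond [RHS]big_seq; apply: eq_bigl => p.
    rewrite mem_filter; case: eqP => //= pm; rewrite mem_set ?andbT //.
  - exact: filter_uniq.
  - by move=> p /=; rewrite mem_filter => /andP[/eqP].
  - move=> [m1 m2] /= mE; rewrite mem_filter /= mE eqxx /=.
    have [sm1|/hf -> ] := eqVneq (size (m1 : multiset nat)) d; last by rewrite mul0r.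
    have [sm2|/hg -> ] := eqVneq (size (m2 : multiset nat)) d'; last by rewrite mulr0.
    case/negP; apply/allpairsP; exists (m1, m2); rewrite !mem_monomials sm1 sm2 !eqxx /=.
    by split=> //; apply/allP => i im; apply: mK; rewrite -mE in_msetD im ?orbT.
rewrite /evaluate -/K.
under eq_big_seq => m mM do rewrite mulE // rmorph_sum /= mulr_suml.
rewrite exchange_big /= big_distrlr /= big_allpairs /=.
rewrite !big_seq; apply: eq_bigr => m1 m1M; rewrite !big_seq; apply: eq_bigr => m2 m2M.
move: m1M m2M; rewrite !mem_monomials => /andP[/eqP sm1 m1K] /andP[/eqP sm2 m2K].
have m12M : (m1 `+` m2)%mset \in monomials K (d + d').
  rewrite mem_monomials (perm_size (perm_msetD _ _)) size_cat sm1 sm2 eqxx /=.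
  by rewrite (perm_all _ (perm_msetD _ _)) all_cat m1K.
rewrite (bigD1_seq _ m12M) ?undup_uniq //= eqxx big1 ?addr0 => [|m /negbTE]; last first.
  by rewrite eq_sym => ->; rewrite rmorph0 mul0r.
by rewrite weightD rmorphM mulrACA.
Qed.

Lemma homogeneous_one : homogeneous 0 ps_one.
Proof.
move=> m; rewrite /ps_one; have [->|//] := eqVneq m mset0.
by rewrite enum_mset0.
Qed.

Lemma evaluate_one zs : evaluate zs 0 ps_one = 1.
Proof.
have m0 : mset0 \in monomials (size zs) 0 by rewrite mem_monomials enum_mset0.
rewrite /evaluate (bigD1_seq _ m0) ?undup_uniq //= big1 => [|m /negbTE m0'].
  by rewrite /ps_one eqxx rmorph1 /weight enum_mset0 big_nil mulr1 addr0.
by rewrite /ps_one m0' rmorph0 mul0r.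
Qed.

Lemma homogeneous_sum (I : choiceType) (D : set I) (mon : I -> multiset nat) n :
  (forall i, D i -> size (mon i) = n) -> homogeneous n (ps_sum D mon).
Proof.
move=> Dn m sm; rewrite /ps_sum fsbig1 // => i /Dn szi.
by case: eqP => // im; rewrite -im szi eqxx in sm.
Qed.

Lemma evaluate_sum zs n (I : choiceType) (D : set I) (mon : I -> multiset nat) (r : seq I) :
  uniq r ->
  (forall i, i \in r <-> D i /\ mon i \in monomials (size zs) n) ->
  evaluate zs n (ps_sum D mon) = \sum_(i <- r) weight zs (mon i).
Proof.
move=> r_uniq rP; rewrite /evaluate.
have sumE m : m \in monomials (size zs) n ->
    ps_sum D mon m = \sum_(i <- r) (mon i == m)%:R.
  move=> mM; rewrite /ps_sum (fsbigE r) //.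
  - rewrite [LHS]big_seq_cond [RHS]big_seq; apply: eq_bigl => i.
    by have [/rP[Di _]|//] := boolP (i \in r); rewrite mem_set.
  - by move=> i /rP[].
  - move=> i Di ir; case: eqP => // im; case/negP: ir; apply/rP.
    by rewrite im.
under eq_big_seq => m mM do rewrite sumE // rmorph_sum /= mulr_suml.
rewrite exchange_big /=; rewrite !big_seq; apply: eq_bigr => i /rP[_ iM].
rewrite (bigD1_seq _ iM) ?undup_uniq //= eqxx rmorph1 mul1r big1 ?addr0 => [//|m /negbTE].
by rewrite eq_sym => ->; rewrite rmorph0 mul0r.
Qed.

(** The generating function of the elementary symmetric functions at [zs]. *)
Definition elem_gf zs : {poly R} := \prod_(z <- zs) (1 + z *: 'X).

Lemma coef_elem_gf zs k :
  (elem_gf zs)`_k = \sum_(A : {set 'I_(size zs)} | #|A| == k) \prod_(i in A) zs`_i.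
Proof.
rewrite /elem_gf (big_nth 0) big_mkord.
under eq_bigr => i _ do rewrite addrC.
rewrite (bigA_distr 1) /= coef_sum [RHS]big_mkcond /=.
apply: eq_bigr => A _; rewrite -big_mkcond scaler_prod /= prodr_const coefZ coefXn.
by rewrite eq_sym; case: eqP; rewrite ?mulr1 ?mulr0.
Qed.

Lemma homogeneous_elem k : homogeneous k (elem k).
Proof.
apply: homogeneous_sum => A /= <-.
by rewrite (perm_size (perm_eq_seq_mset _)) cardfE.
Qed.

Lemma weight_seq_mset zs s : weight zs (seq_mset s) = \prod_(i <- s) zs`_i.
Proof. exact/perm_big/perm_eq_seq_mset. Qed.

Lemma evaluate_elem zs k : evaluate zs k (elem k) = (elem_gf zs)`_k.
Proof.
set K := size zs.
pose up (A : {set 'I_K}) : {fset nat} := [fset val i | i in A]%fset.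
have up_inj : injective up.
  move=> A B /fsetP AB; apply/setP => i; have := AB (val i).
  by rewrite !mem_imfset //; apply: val_inj.
have card_up A : #|` up A|%fset = #|A|.
  by rewrite card_imfset //=; [rewrite -cardE | exact: val_inj].
have up_lt A i : i \in up A -> (i < K)%N by case/imfsetP => j _ ->; exact: ltn_ord.
rewrite (@evaluate_sum _ _ _ _ _ [seq up A | A : {set 'I_K} in [pred A : {set 'I_K} | #|A| == k]]).
- rewrite big_image coef_elem_gf; apply: eq_bigr => A _.
  by rewrite weight_seq_mset big_imfset /= ?big_enum //; move=> ? ? _ _; exact: val_inj.
- by rewrite map_inj_uniq ?enum_uniq.
move=> B; rewrite mem_monomials (perm_size (perm_eq_seq_mset _)) (perm_all _ (perm_eq_seq_mset _)).
split=> [/imageP[A /eqP Ak ->]|[/= Bk /andP[_ /allP BK]]].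
  by rewrite /= card_up Ak eqxx; split=> //; apply/allP => i /up_lt.
have upB : up [set i : 'I_K | val i \in B] = B.
  apply/fsetP => i; apply/imfsetP/idP => /= [[j]|iB]; first by rewrite inE => ? ->.
  by exists (Ordinal (BK _ iB)); rewrite ?inE.
apply/imageP; exists [set i : 'I_K | val i \in B]; last by rewrite upB.
by rewrite !inE -card_up upB Bk.
Qed.

Lemma evaluate_chromatic (G : sgraph) zs :
  evaluate zs #|G| (chromatic_sym G) =
  \sum_(kappa : {ffun G -> 'I_(size zs)} | [forall p in edge_set G, kappa p.1 != kappa p.2])
    \prod_v zs`_(kappa v).
Proof.
set K := size zs.
pose up (k : {ffun G -> 'I_K}) := [ffun v => val (k v)].
have up_inj : injective up.
  by move=> k l /ffunP kl; apply/ffunP => v; apply: val_inj; have := kl v; rewrite !ffunE.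
rewrite (@evaluate_sum _ _ _ _ _ [seq up k | k : {ffun G -> 'I_K} in
    [pred k : {ffun G -> 'I_K} | [forall p in edge_set G, k p.1 != k p.2]]]).
- rewrite big_image; apply: eq_bigr => k _.
  rewrite weight_seq_mset big_map big_enum /=; apply: eq_bigr => v _.
  by rewrite ffunE.
- by rewrite map_inj_uniq ?enum_uniq.
move=> kappa; rewrite mem_monomials (perm_size (perm_eq_seq_mset _)) (perm_all _ (perm_eq_seq_mset _)).
rewrite size_map -cardE eqxx /=.
split=> [/imageP[k /forall_inP kP ->]|[proper_kappa /allP kK]].
  split=> [x y xy|].
    by rewrite !ffunE; apply: (kP (x, y)); rewrite inE.
  by apply/allP => i /mapP[v _ ->]; rewrite ffunE; exact: ltn_ord.
have kK' v : (kappa v < K)%N by apply/kK/map_f; rewrite mem_enum.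
apply/imageP; exists [ffun v => Ordinal (kK' v)].
  apply/forall_inP => -[x y]; rewrite inE !ffunE => /proper_kappa.
  by apply: contra => /eqP[->].
by apply/ffunP => v; rewrite !ffunE.
Qed.

Lemma homogeneous_elem_part (la : seq nat) :
  homogeneous (sumn la) (\big[ps_mul/ps_one]_(k <- la) elem k).
Proof.
elim: la => [|k la IH]; rewrite ?big_nil ?big_cons /=; first exact: homogeneous_one.
exact: homogeneous_mul (@homogeneous_elem k) IH.
Qed.

Lemma evaluate_elem_part zs (la : seq nat) :
  evaluate zs (sumn la) (\big[ps_mul/ps_one]_(k <- la) elem k) =
  \prod_(k <- la) (elem_gf zs)`_k.
Proof.
elim: la => [|k la IH]; rewrite ?big_nil ?big_cons /=; first exact: evaluate_one.
rewrite evaluate_mul ?evaluate_elem ?IH //; first exact: homogeneous_elem.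
exact: homogeneous_elem_part.
Qed.

(** A homogeneous series evaluates to 0 in every degree but its own, which
confines the expansion to the partitions of [n]. *)
Lemma evaluate_e_expansion (f : series) (c : {fsfun intpart -> rat with 0}) zs n :
  e_expansion f c ->
  evaluate zs n f =
  \sum_(la <- finsupp c | sumn la == n)
    ratr (c la) * \prod_(k <- la) (elem_gf zs)`_k.
Proof.
move=> fE; rewrite /evaluate.
under eq_bigr => m _ do rewrite fE rmorph_sum /= mulr_suml.
rewrite exchange_big /= [RHS]big_mkcond; apply: eq_bigr => la _.
under eq_bigr => m _ do rewrite rmorphM /= -mulrA.
rewrite -mulr_sumr; have [<-|la_n] := eqVneq (sumn la) n.
  by rewrite -evaluate_elem_part.
rewrite (_ : \sum_(_ <- _) _ = evaluate zs n (elem_part la)) //.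
by rewrite (evaluate_homogeneous _ (@homogeneous_elem_part la)) ?mulr0.
Qed.

End Evaluation.

(** * Lists of roots that isolate one power sum *)

Definition power_sum (R : pzRingType) (zs : seq R) (j : nat) : R :=
  \sum_(z <- zs) z ^+ j.

(** The numbers are the opposites of the inverses of the a-th roots of -1; their
power sums are geometric sums of roots of unity. *)
Lemma exists_roots_gf (a : nat) : (0 < a)%N ->
  {zs : seq algC | [/\ elem_gf zs = 1 + 'X^a,
    forall j, ~~ (a %| j)%N -> power_sum zs j = 0 & power_sum zs a != 0]}.
Proof.
move=> a_gt0; have [zeta prim_zeta] := C_prim_root_exists a_gt0.
pose c : algC := a.-root (-1); have ca : c ^+ a = -1 by rewrite rootCK.
have c_neq0 : c != 0.
  by apply/eqP => c0; move/eqP: ca; rewrite c0 expr0n gtn_eqF // eq_sym oppr_eq0 oner_eq0.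
have zeta_neq0 : zeta != 0 by rewrite (prim_root_eq0 prim_zeta) -lt0n.
exists [seq - c * zeta ^- i | i <- index_iota 0 a]; split.
- pose C := \prod_(i <- index_iota 0 a) (- zeta ^- i).
  have gfE : elem_gf [seq - c * zeta ^- i | i <- index_iota 0 a] = (- C) *: (1 + 'X^a).
    rewrite /elem_gf big_map.
    transitivity (\prod_(i <- index_iota 0 a) ((- zeta ^- i) *: (('X - (zeta ^+ i)%:P) \Po (c *: 'X)))).
      apply: eq_bigr => i _; rewrite comp_polyB comp_polyX comp_polyC.
      rewrite scalerBr scalerA scale_polyC [X in _ - X%:P]mulNr mulVf ?expf_neq0 //.
      by rewrite polyCN opprK addrC !mulNr [c * _]mulrC.
    rewrite -/C scaler_prod -rmorph_prod /=.
    rewrite (factor_Xn_sub_1 prim_zeta).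
    rewrite comp_polyB comp_Xn_poly -polyC1 comp_polyC polyC1 exprZn ca -/C.
    by rewrite scaleN1r -opprD scalerN scaleNr addrC.
  (* The constant factor is found by comparing constant coefficients. *)
  rewrite gfE; suff -> : - C = 1 by rewrite scale1r.
  have := congr1 (fun p : {poly algC} => p`_0) gfE.
  rewrite coefZ coefD coef1 coefXn (ltn_eqF a_gt0) /= addr0 mulr1 => <-.
  rewrite -horner_coef0 horner_prod big1_seq // => z _.
  by rewrite !hornerE ?mulr0 ?addr0.
- move=> j aj; rewrite /power_sum big_map.
  under eq_bigr => i _ do rewrite exprMn exprVn -exprM mulnC exprM -exprVn.
  rewrite -mulr_sumr; apply/eqP; rewrite mulf_eq0; apply/orP; right.
  have x1 : (zeta ^+ j)^-1 - 1 != 0.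
    rewrite subr_eq0 invr_eq1; apply: contra aj => /eqP zj.
    by rewrite (prim_order_dvd prim_zeta) zj.
  rewrite -(mulrI_eq0 _ (mulfI x1)) big_mkord.
  by rewrite -subrX1 exprVn -exprM mulnC exprM (prim_expr_order prim_zeta) expr1n invr1 subrr.
- rewrite /power_sum big_map.
  under eq_bigr => i _ do rewrite exprMn exprVn -exprM mulnC exprM
    (prim_expr_order prim_zeta) expr1n invr1 mulr1.
  rewrite big_const_nat subn0 iter_addr_0.
  by rewrite mulrn_eq0 negb_or -lt0n a_gt0 expf_neq0 // oppr_eq0.
Qed.

(** * Products of sums *)

(** The expansion of the product of the [u i + v i] contains both products among
its nonnegative terms. *)
Lemma prodr_superadditive (R : numDomainType) (I : eqType) (s : seq I) (u v w : I -> R) :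
  s != [::] -> (forall i, i \in s -> [/\ 0 <= u i, 0 <= v i & u i + v i <= w i]) ->
  \prod_(i <- s) u i + \prod_(i <- s) v i <= \prod_(i <- s) w i.
Proof.
case: s => // i s _; elim: s i => [|j s IH] i uvw; first by rewrite !big_seq1; case: (uvw i); rewrite ?inE.
rewrite !(big_cons _ _ i); have [ui vi uvi] := uvw i (mem_head _ _).
have uvw' k : k \in j :: s -> [/\ 0 <= u k, 0 <= v k & u k + v k <= w k].
  by move=> ks; apply: uvw; rewrite inE ks orbT.
have U0 : 0 <= \prod_(k <- j :: s) u k by rewrite big_seq prodr_ge0 // => k /uvw'[].
have V0 : 0 <= \prod_(k <- j :: s) v k by rewrite big_seq prodr_ge0 // => k /uvw'[].
apply: le_trans (ler_wpM2r (le_trans (addr_ge0 U0 V0) (IH _ uvw')) uvi).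
rewrite mulrDl lerD // ler_wpM2l //; apply: le_trans (IH _ uvw').
  by rewrite lerDl.
by rewrite lerDr.
Qed.

(** In the expansion of the product of the sums, every mixed term contains a
factor [x i * y j] with distinct [i] and [j]. *)
Lemma prodrD_separated (R : idomainType) (I : finType) (P : {set I}) (x y : I -> R) :
  P != set0 ->
  (forall i j, i \in P -> j \in P -> i != j -> x i * y j = 0) ->
  \prod_(i in P) (x i + y i) = \prod_(i in P) x i + \prod_(i in P) y i.
Proof.
move=> /set0Pn[i0 i0P] xy.
have prod0 (f : I -> R) i : i \in P -> f i = 0 -> \prod_(j in P) f j = 0.
  by move=> iP fi; rewrite (bigD1 i) //= fi mul0r.
have [/existsP[i /andP[iP xi]]|] := boolP [exists i, (i \in P) && (x i != 0)]; last first.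
  rewrite negb_exists => /forallP x0.
  have x0' i : i \in P -> x i = 0 by move=> iP; have := x0 i; rewrite iP negbK => /eqP.
  rewrite (prod0 x i0) ?x0' // add0r; apply: eq_bigr => i /x0' ->.
  by rewrite add0r.
have yj j : j \in P -> j != i -> y j = 0.
  rewrite eq_sym => jP ij; have /eqP := xy i j iP jP ij.
  by rewrite mulf_eq0 (negbTE xi) => /eqP.
have [Pi|] := boolP [exists j, (j \in P) && (j != i)]; last first.
  rewrite negb_exists => /forallP Pi.
  have Pi' : P =i pred1 i.
    move=> j; rewrite inE; apply/idP/eqP => [jP|-> //]; apply/eqP.
    by have := Pi j; rewrite jP negbK.
  by rewrite !(eq_bigl _ _ Pi') !big_pred1_eq.
have /existsP[j /andP[jP ji]] := Pi.
rewrite (prod0 y j) ?yj // addr0.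
have [yi|yi] := eqVneq (y i) 0.
  apply: eq_bigr => k kP; have [->|ki] := eqVneq k i; first by rewrite yi addr0.
  by rewrite yj ?addr0.
have xj : x j = 0.
  by have /eqP := xy j i jP iP ji; rewrite mulf_eq0 (negbTE yi) orbF => /eqP.
by rewrite (prod0 (fun k => x k + y k) j) ?(prod0 x j) // xj yj ?addr0.
Qed.

(** * Connected partitions of e-positive graphs *)

Section Wolfgang.
Variable G : sgraph.

Lemma components_connected_partition (S : {set G * G}) :
  S \subset edge_set G -> connected_partition (components S).
Proof.
move=> sSE; split; first exact: components_partition.
move=> A AS.
split.
  by rewrite /= card_sig (eq_card (B := A)) ?(component_card AS).
move=> [x xA] [y yA]; have := yA; rewrite (mem_component _ AS xA) => /connectP[p].
have same u v (uA : u \in A) (vA : v \in A) : u = v ->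
    connect (@edge (induced A)) (exist _ u uA) (exist _ v vA).
  by move=> uv; case: _ / uv vA => vA; rewrite (bool_irrelevance uA vA) connect0.
elim: p x xA => [|z p IH] x xA /= => [_ yx|/andP[xz zp] yE]; first exact: same.
have zA : z \in A by rewrite (mem_component _ AS xA) connect1.
apply: connect_trans (IH z zA zp yE).
have [xz'|xz'] := eqVneq x z; first exact: same.
apply: connect1; rewrite /= /induced_edge /=.
case/or3P: xz => [/eqP xz|/(subsetP sSE)|/(subsetP sSE)]; rewrite ?inE //=.
- by rewrite xz eqxx in xz'.
- by rewrite edge_sym.
Qed.

Lemma evaluate_chromatic_power_sums (zs : seq algC) :
  evaluate zs #|G| (chromatic_sym G) =
  \sum_(S : {set G * G} | S \subset edge_set G)
    (-1) ^+ #|S| * \prod_(C in components S) power_sum zs #|C|.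
Proof.
rewrite evaluate_chromatic (sum_proper_colorings G (fun i : 'I_(size zs) => zs`_i)).
apply: eq_bigr => S _; congr (_ * _); apply: eq_bigr => C _.
by rewrite /power_sum (big_nth 0) big_mkord.
Qed.

(** Under these conditions on [zs], Whitney's formula keeps only the edge sets
that connect [G], each with the same nonzero factor. *)
Lemma evaluate_chromatic_neq0 (zs : seq algC) : connected_graph G ->
  (forall j, ~~ (#|G| %| j)%N -> power_sum zs j = 0) -> power_sum zs #|G| != 0 ->
  evaluate zs #|G| (chromatic_sym G) != 0.
Proof.
move=> [G0 connG] ps0 psn.
rewrite evaluate_chromatic_power_sums.
have -> : \sum_(S : {set G * G} | S \subset edge_set G)
    (-1) ^+ #|S| * \prod_(C in components S) power_sum zs #|C| =
    connecting_sum algC (edge_set G) id * power_sum zs #|G|.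
  rewrite /connecting_sum mulr_suml; apply: eq_bigr => S _.
  have /and3P[/eqP coverS _ _] := components_partition S.
  have /card_gt0P[t _] := G0; have tS := component_pblock S t.
  have [/connectingP cS|ncS] := boolP (connecting S id).
    rewrite mulr1n (big_pred1 [set: G]) ?cardsT // => C; rewrite /=.
    apply/idP/eqP => [CS|->].
      have /card_gt0P[x xC] := component_card CS.
      by apply/setP => y; rewrite inE (mem_component _ CS xC) cS.
    rewrite [X in X \in _](_ : _ = pblock (components S) t) //.
    by apply/setP => y; rewrite inE (mem_component (x := t) _ tS) ?cS // mem_pblock coverS.
  rewrite mulr0n mul0r.
  (* The component of [t] is a proper subset, so [#|G|] does not divide its size. *)
  rewrite (bigD1 (pblock (components S) t)) //= ps0 ?mul0r ?mulr0 //.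
  rewrite gtnNdvd ?(component_card tS) // -cardsT; apply: proper_card.
  rewrite properT; apply: contra ncS => /eqP tT; apply/connectingP => x y.
  by rewrite -(mem_component (C := [set: G])) ?inE // -tT.
rewrite mulf_neq0 //.
have [_ ] := connecting_sum_sign algC (edge_set G) id G0.
have cE : connecting (edge_set G) id.
  apply/connectingP => x y; apply: connect_sub (connG x y) => u v uv.
  by apply: connect1; rewrite /contracted_edge inE /= uv orbT.
have loopless (p : G * G) : p \in edge_set G -> p.1 != p.2.
  by rewrite inE; apply: contraTneq => ->; rewrite edge_irr.
by move=> /(_ cE loopless); case: eqP => // ->; rewrite mulr0 ltxx.
Qed.

(** Wolfgang's theorem for partitions into two parts. *)
Lemma connected_partition_of_e_positive (a b : nat) :
  connected_graph G -> e_positive G -> (0 < b <= a)%N -> (a + b = #|G|)%N ->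
  has_connected_partition G [:: a; b].
Proof.
move=> connG [c cE c_ge0] /andP[b_gt0 ba] abG; have a_gt0 := leq_trans b_gt0 ba.
have n_gt0 : (0 < #|G|)%N by rewrite -abG addn_gt0 a_gt0.
apply: contrapT => noP.
have [za [gfa psa _]] := exists_roots_gf a_gt0.
have [zb [gfb psb _]] := exists_roots_gf b_gt0.
have [zn [gfn psn psn0]] := exists_roots_gf n_gt0.
have gfab : elem_gf (za ++ zb) = (1 + 'X^a) * (1 + 'X^b).
  by rewrite /elem_gf big_cat -/(elem_gf _) gfa -/(elem_gf _) gfb.
have additive : evaluate (za ++ zb) #|G| (chromatic_sym G) =
    evaluate za #|G| (chromatic_sym G) + evaluate zb #|G| (chromatic_sym G).
  rewrite !evaluate_chromatic_power_sums -big_split; apply: eq_bigr => S sSE /=.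
  rewrite -mulrDr; congr (_ * _).
  rewrite -prodrD_separated.
  - by apply: eq_bigr => C _; rewrite /power_sum big_cat.
  - have /card_gt0P[t _] := n_gt0.
    by apply/set0Pn; exists (pblock (components S) t); exact: component_pblock.
  (* A nonzero mixed term gives two components of sizes at least [a] and [b],
     which exhaust the [a + b] vertices. *)
  move=> A B AS BS AB; apply/eqP; rewrite mulf_eq0 -implyNb.
  apply/implyP => pA; apply: contrapT => /negP pB; case: noP.
  have aA : (a %| #|A|)%N by apply: contraNT pA => /psa ->.
  have bB : (b %| #|B|)%N by apply: contraNT pB => /psb ->.
  have leA := dvdn_leq (component_card AS) aA; have leB := dvdn_leq (component_card BS) bB.
  have := card_partition (components_partition S).
  rewrite cardsT -abG (bigD1 A) //= (bigD1 B) /=; last by rewrite BS eq_sym.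
  set r := (X in (_ + (_ + X))%N) => sizes.
  have [sA sB r0] : [/\ #|A| = a, #|B| = b & r = 0%N] by split; lia.
  exists (components S); first exact: components_connected_partition.
  have perm2 : perm_eq (enum (components S)) [:: A; B].
    apply: uniq_perm; rewrite ?enum_uniq //= ?inE ?AB // => C.
    rewrite mem_enum !inE; apply/idP/orP => [CS|[]/eqP->//].
    apply/orP; rewrite -[_ || _]negbK negb_or; apply/negP => CAB.
    move: r0; rewrite /r (bigD1 C) /=; last by rewrite CS.
    by have := component_card CS; case: #|C|.
  rewrite /partition_type (_ : sort geq _ = sort geq [:: a; b]).
    by apply: sorted_sort => [x y z|]; rewrite /= ?andbT //; exact: (rev_trans leq_trans).
  apply/perm_sortP.
  - by move=> x y; exact: leq_total.
  - by move=> x y z; exact: (rev_trans leq_trans).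
  - by move=> x y /andP[yx xy]; apply/anti_leq/andP; split; [exact: xy | exact: yx].
  by rewrite -sA -sB; exact: (perm_map (fun C : {set G} => #|C|) perm2).
have coef_gf j k : (0 < k)%N -> (1 + 'X^j : {poly algC})`_k = (k == j)%:R.
  by move=> k_gt0; rewrite coefD coef1 coefXn gtn_eqF // add0r.
have coef_gf2 k : (0 < k)%N ->
    ((1 + 'X^a) * (1 + 'X^b) : {poly algC})`_k = (k == a)%:R + (k == b)%:R + (k == #|G|)%:R.
  move=> k_gt0; rewrite mulrDl mul1r mulrDr mulr1 -exprD abG addrACA !coefD coef1 !coefXn gtn_eqF //.
  by rewrite add0r addrA.
have part_gt0 (la : intpart) k : k \in (la : seq nat) -> (0 < k)%N.
  case: la => s /= /andP[_ s0] ks; rewrite lt0n; by apply: contra s0 => /eqP <-.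
(* The evaluation at [zn] finds an e_la whose parts are all equal to n; its
   coefficient is positive and it violates additivity. *)
have [la c_la /andP[/eqP la_n gf_la]] : exists2 la : intpart, la \in finsupp c &
    (sumn la == #|G|) && (\prod_(k <- la) (elem_gf zn)`_k != 0).
  apply/hasP; have := evaluate_chromatic_neq0 connG psn psn0.
  rewrite (evaluate_e_expansion _ _ cE); apply: contraR => /hasPn nola.
  rewrite big_seq_cond big1 // => la /andP[/nola + sla].
  by rewrite sla negbK => /eqP ->; rewrite mulr0.
have la_neq0 : (la : seq nat) != [::] by apply: contraTneq n_gt0 => la0; rewrite -la_n la0.
have la_const k : k \in (la : seq nat) -> k = #|G|.
  move=> kla; have k0 := part_gt0 la k kla; apply/eqP; apply: contraNT gf_la => kG.
  by rewrite (big_rem k) //= gfn coef_gf // (negbTE kG) mul0r.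
move/eqP: additive; rewrite !(evaluate_e_expansion _ _ cE) -subr_eq0 -big_split -sumrB /=.
have term_ge0 (mu : intpart) : sumn mu = #|G| ->
    \prod_(k <- mu) (elem_gf za)`_k + \prod_(k <- mu) (elem_gf zb)`_k <=
    \prod_(k <- mu) (elem_gf (za ++ zb))`_k.
  move=> mu_n; apply: prodr_superadditive => [|k /part_gt0 k0].
    by apply: contraTneq n_gt0 => mu0; rewrite -mu_n mu0.
  by rewrite gfa gfb gfab !coef_gf // coef_gf2 // !ler0n lerDl ler0n.
rewrite psumr_eq0 => [/allP/(_ la c_la)|mu /eqP mu_n]; last first.
  by rewrite -mulrDr -mulrBr mulr_ge0 ?ler0q ?c_ge0 // subr_ge0 term_ge0.
rewrite la_n eqxx /= -mulrDr -mulrBr mulf_eq0 fmorph_eq0.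
have /negbTE -> /= : c la != 0 by rewrite -mem_finsupp.
have neq_n j : (0 < j < #|G|)%N -> \prod_(k <- la) (1 + 'X^j : {poly algC})`_k = 0.
  move=> /andP[j0 jn]; case: (la : seq nat) la_neq0 la_const => // k s _ kn.
  by rewrite big_cons coef_gf (kn k) ?mem_head // gtn_eqF // mul0r.
rewrite gfa gfb !neq_n ?a_gt0 ?b_gt0 -?abG /=; [|lia|lia].
rewrite addr0 subr0 gfab big1_seq ?oner_eq0 // => k /andP[_ /la_const ->].
by rewrite coef_gf2 // eqxx -abG !gtn_eqF ?add0r //; lia.
Qed.

End Wolfgang.

(** * The sun *)

Section Sun.
Variables l1 l2 l3 : nat.
Let G := sun3 l1 l2 l3.

Definition branch (u : G) : 'I_3 :=
  match u with inl i => i | inr q => tag q end.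

Definition in_triangle (u : G) : bool := if u is inl _ then true else false.

Lemma in_triangleE (u : G) : in_triangle u -> u = inl (branch u).
Proof. by case: u. Qed.

Lemma edge_branch (u v : G) : edge u v ->
  [|| branch u == branch v | in_triangle u && in_triangle v].
Proof.
case: u v => [i|p] [j|q] /=; rewrite ?orbT ?orbF // => /andP[tag_eq _] //.
by rewrite eq_sym.
Qed.

Lemma card_sun : #|G| = (l1 + l2 + l3 + 3)%N.
Proof.
rewrite card_sum card_ord card_tagged sumnE big_map big_enum /=.
rewrite !big_ord_recl big_ord0 /= !card_ord /sun_arm !(tnth_nth 0%N) /=.
by rewrite addn0 addnC !addnA.
Qed.

Lemma card_branch (i : 'I_3) : #|[set u : G | branch u == i]| = (sun_arm l1 l2 l3 i).+1.
Proof.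
pose f (o : option 'I_(sun_arm l1 l2 l3 i)) : G :=
  if o is Some k then inr (Tagged (fun i => 'I_(sun_arm l1 l2 l3 i)) k) else inl i.
have f_inj : injective f.
  move=> [k|] [l|] //= [] /eqP; rewrite -tag_eqE /tag_eq /= eqxx tagged_asE => /eqP -> //.
have -> : [set u : G | branch u == i] = f @: [set: option 'I_(sun_arm l1 l2 l3 i)].
  apply/setP => u; rewrite inE; apply/eqP/imsetP => [|[[k|] _ ->] //].
  case: u => [j /= ->|[j k] /= ji]; first by exists None; rewrite ?inE.
  by move: k; rewrite ji => k; exists (Some k); rewrite ?inE.
by rewrite card_imset // cardsT card_option card_ord.
Qed.

Lemma connected_sun : connected_graph G.
Proof.
split; first by rewrite card_sun addnS.
have to_branch (u : G) : connect (@edge G) (inl (branch u)) u.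
  case: u => [i|[i [k ik]]] /=; first exact: connect0.
  elim: k ik => [|k IH] ik; first by apply: connect1; rewrite /= !eqxx.
  apply: connect_trans (IH (ltnW ik)) (connect1 _).
  by rewrite /= !eqxx.
have sym : connect_sym (@edge G) by apply/sym_connect_sym/edge_sym.
move=> x y; apply: connect_trans (_ : connect _ x (inl (branch x))) _; first by rewrite sym.
apply: connect_trans (to_branch y).
have [->|xy] := eqVneq (branch x) (branch y); first exact: connect0.
exact: connect1.
Qed.

(** An edge between two branches joins two triangle vertices, so a path inside
[A] never leaves its branch. *)
Lemma connected_in_branch (A : {set G}) (u : G) : connected_graph (induced A) ->
  u \in A -> (forall v w, v \in A -> w \in A -> in_triangle v -> in_triangle w -> v = w) ->
  A \subset [set v : G | branch v == branch u].
Proof.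
move=> [_ connA] uA tri; apply/subsetP => v vA; rewrite inE.
have /connectP[p] := connA (exist _ u uA) (exist _ v vA).
elim: p u uA => [|[w wA] p IH] u uA /=; first by move=> _ [->].
case/andP => uw wp vE; rewrite (eqP (IH w wA wp vE)).
move: uw; rewrite /induced_edge /= => uw.
have /orP[/eqP ->//|/andP[tu tw]] := edge_branch uw.
by rewrite (tri _ _ uA wA tu tw).
Qed.

(** A part that fits in no branch contains two of the three triangle vertices,
and two disjoint parts cannot both do so. *)
Lemma no_connected_bipartition_of_big_parts (s : seq nat) :
  size s = 2 -> (forall i, all (fun k => sun_arm l1 l2 l3 i + 1 < k)%N s) ->
  ~ has_connected_partition G s.
Proof.
move=> s2 big_s [P [partP connP] typeP].
have big_block A : A \in P -> exists v w,
    [/\ v \in A, w \in A, in_triangle v, in_triangle w & v != w].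
  move=> AP; apply: contrapT => noA.
  have [G0 _] := connP A AP; have /card_gt0P[[u uA] _] := G0.
  have sA : #|A| \in s.
    by rewrite -typeP mem_sort; apply: map_f; rewrite mem_enum.
  have /allP/(_ _ sA) := big_s (branch u); rewrite addn1 ltnNge -card_branch => /negP[].
  apply: subset_leq_card; apply: connected_in_branch (connP A AP) uA _.
  move=> v w vA wA tv tw; apply: contrapT => /eqP vw; apply: noA.
  by exists v, w.
have : #|P| = 2 by rewrite -s2 -typeP size_sort size_map -cardE.
move/eqP/cards2P => [A [B [AB PE]]].
have /and3P[_ /trivIsetP trivP _] := partP.
have dAB : [disjoint A & B] by apply: trivP; rewrite ?PE ?inE ?eqxx ?orbT.
pose tr (A : {set G}) := [set i : 'I_3 | (inl i : G) \in A].
have tr2 C : C \in P -> (1 < #|tr C|)%N.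
  move=> /big_block[v [w [vC wC tv tw vw]]]; apply/card_gt1P.
  exists (branch v), (branch w); rewrite !inE -!in_triangleE //; split=> //.
  by apply: contra vw => /eqP bvw; rewrite (in_triangleE tv) bvw -in_triangleE.
have dtr : [disjoint tr A & tr B].
  rewrite -setI_eq0; apply/eqP/setP => i; rewrite !inE; apply/negP => /andP[iA iB].
  by have := disjointFr dAB iA; rewrite iB.
have := max_card (mem (tr A :|: tr B)); rewrite card_ord cardsU disjoint_setI0 // cards0.
have := tr2 A; have := tr2 B; rewrite !PE !inE !eqxx orbT => /(_ isT) + /(_ isT).
lia.
Qed.

End Sun.

Theorem theorem3p14 (l1 l2 l3 : nat)
  (l1_gt0 : (0 < l1)%N) (l2_gt0 : (0 < l2)%N) (l3_gt0 : (0 < l3)%N)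
  (l1_max : l1 = maxn l1 (maxn l2 l3))
  (l1_lt : (l1 < l2 + l3)%N) :
  ~ has_connected_partition (sun3 l1 l2 l3) [:: (l2 + l3 + 1)%N; (l1 + 2)%N]
  /\ ~ e_positive (sun3 l1 l2 l3).
Proof.
have noP : ~ has_connected_partition (sun3 l1 l2 l3) [:: (l2 + l3 + 1)%N; (l1 + 2)%N].
  apply: no_connected_bipartition_of_big_parts => // i.
  have : (sun_arm l1 l2 l3 i <= l1)%N.
    by rewrite /sun_arm; case: i => [[|[|[]]] //= ?]; rewrite !(tnth_nth 0%N) /=; lia.
  by move=> ? /=; lia.
split=> // epos; apply: noP.
apply: connected_partition_of_e_positive epos _ _; first exact: connected_sun.
  lia.
rewrite card_sun; lia.
Qed.
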